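(* Let $\beta\in(0,1)$, $\rho\in[0,1)$, $\epsilon>0$, and let $B$ be a $2\times2$ row-stochastic TP2 observation matrix ($\det B\ge0$). Let the quality $x$ be a random variable (constant in time) with initial belief $\pi_0\in\Pi(2)$, let $\pi_k$, $k\ge0$, be the public belief generated under the optimal pricing policy $\mu^*$ (for either the self-interested or the altruistic reward; see context), with prices $u_k=\mu^*(\pi_{k-1})$ and sensor actions $a_k$, $k\ge1$, and let $\mathcal F_k$ be the $\sigma$-algebra generated by $(u_1,a_1,u_2,a_2,\dots,u_k,a_k)$ ($\mathcal F_0$ trivial). Then, for any $\alpha\in(0,1]$, the optimal price sequence $u_k=\mu^*(\pi_{k-1})$ is a super-martingale (it decreases on average over time): $$\mathbb E[u_{k+1}\mid\mathcal F_{k-1}]\le u_k\quad\text{for all }k\ge1,$$ that is, $\mathbb E[\mu^*(\pi_{k})\mid\mathcal F_{k-1}]\le\mu^*(\pi_{k-1})$.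
   Context: $\Pi(2)=\{\pi\in\mathbb R^2:\pi(1)+\pi(2)=1,\ 0\le\pi(i)\le1\}$; $x\in\{1,2\}$ is the state (low/high quality). At time $k$ sensor $k$ receives a private observation $y_k\in\{1,2\}$ with $\mathbb P(y_k=j\mid x=i)=B_{ij}$. $B_y=\mathrm{diag}(B_{1y},B_{2y})$, $\mathbf 1=(1,1)'$, $\eta^y=B_y\pi/(\mathbf 1'B_y\pi)$. Given the public belief $\pi=\pi_{k-1}$ and price $u_k$, sensor $k$ minimizes over $a\in\{1,2\}$ the conditional value-at-risk $\min_{z\in\mathbb R}\{z+\frac1\alpha\mathbb E[\max\{c(x,a)-z,0\}]\}$ with $x\sim\eta^{y_k}$ and costs $c(x,1)=0$, $c(1,2)=u_k$, $c(2,2)=u_k-1$; this amounts to choosing $a_k=2$ (utilize) iff $u_k\le1-\eta^{y_k}(1)/\alpha$ and $a_k=1$ otherwise. The public belief is $\pi_k(i)=\mathbb P(x=i\mid a_1,\dots,a_k)$, updated by Bayes' rule. Prices: $u^{H}(\pi)=1-\eta^{y=2}(1)/\alpha$, $u^{L}(\pi)=1-\eta^{y=1}(1)/\alpha$. The controller maximizes the expected total reward discounted by $\rho$; with service cost $\beta$, its reward at each time is $(u_k-\beta)$ earned when the sensor utilizes (self-interested) or when the sensor acts according to its valuation, $a_k=y_k$ (altruistic). With $\mathbb EV(\pi)=(\mathbf 1'B_{y=1}\pi)V(\eta^{y=1})+(\mathbf 1'B_{y=2}\pi)V(\eta^{y=2})$, the value function $V$ satisfies Self-interested: $V(\pi)=\max\{0,\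 (u^L(\pi)-\beta)+\rho V(\pi),\ (u^H(\pi)-\beta)\mathbf 1'B_{y=2}\pi+\rho\,\mathbb EV(\pi)\}$; Altruistic: $V(\pi)=\max\{0,\ (u^H(\pi)-\beta)+\rho\,\mathbb EV(\pi)\}$. The optimal policy $\mu^*$ selects the price of the branch attaining this maximum, where branch $0$ (cut-off) corresponds to the price $u^H(\pi)+\epsilon$, with $\epsilon>0$. It has the following form. Self-interested, with thresholds $\pi^*(2),\pi^{**}(2)\in[0,1]$: $\mu^*(\pi)=u^H(\pi)+\epsilon$ for $\pi(2)\in[0,\pi^*(2))$; $\mu^*(\pi)=u^H(\pi)$ for $\pi(2)\in[\pi^*(2),\pi^{**}(2))$; $\mu^*(\pi)=u^L(\pi)$ for $\pi(2)\in[\pi^{**}(2),1]$. Altruistic, with a threshold $\hat\pi^*(2)\in(0,1)$: $\mu^*(\pi)=u^H(\pi)+\epsilon$ for $\pi(2)\in[0,\hat\pi^*(2))$ and $\mu^*(\pi)=u^H(\pi)$ for $\pi(2)\in[\hat\pi^*(2),1]$.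
   Formalization: The claim fails for large ε; the formal theorem asserts it for all sufficiently small ε>0, with a bound depending only on B, α, β, ρ and the choice of reward (not on the policy, π_0 or k). *)

(* Defs.v *)
(* MathComp / MathComp-Analysis *)
From HB Require Import structures.
From mathcomp Require Import all_boot all_order all_algebra.
From mathcomp Require Import all_classical all_reals all_analysis.

Set Implicit Arguments.
Unset Strict Implicit.
Unset Printing Implicit Defensive.

Import Order.TTheory GRing.Theory Num.Theory.
Import numFieldNormedType.Exports.

Local Open Scope classical_set_scope.
Local Open Scope ring_scope.

(* States, observations and actions range over {1, 2}, encoded in 'I_2 with an
   index shift: i1 stands for 1 (low quality; do not utilize) and i2 for 2
   (high quality; utilize). *)
Definition i1 : 'I_2 := ord0.
Definition i2 : 'I_2 := ord_max.

Definition belief (R : realType) (pi : 'cV[R]_2) : Prop :=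
  pi i1 0 + pi i2 0 = 1 /\ forall i, 0 <= pi i 0 <= 1.

Definition row_stochastic (R : realType) (B : 'M[R]_2) : Prop :=
  (forall i j, 0 <= B i j) /\ forall i, \sum_j B i j = 1.

Definition TP2 (R : realType) (B : 'M[R]_2) : Prop := 0 <= \det B.

Definition obs_mx (R : realType) (B : 'M[R]_2) (y : 'I_2) : 'M[R]_2 :=
  diag_mx (\row_i B i y).

(* 1' B_y pi *)
Definition obs_prob (R : realType) (B : 'M[R]_2) (y : 'I_2) (pi : 'cV[R]_2) : R :=
  ((const_mx 1 : 'rV[R]_2) *m (obs_mx B y *m pi)) 0 0.

(* B_y pi / (1' B_y pi).  The quotient is meaningless when y has probability 0
   under pi; such an observation is taken to leave the belief unchanged. *)
Definition eta (R : realType) (B : 'M[R]_2) (y : 'I_2) (pi : 'cV[R]_2) : 'cV[R]_2 :=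
  if obs_prob B y pi == 0 then pi
  else (obs_prob B y pi)^-1 *: (obs_mx B y *m pi).

(* Highest price at which a sensor with observation y utilizes: its conditional
   value-at-risk criterion at level alpha is resolved by the decision rule
   "utilize iff u <= 1 - eta^y(1) / alpha". *)
Definition wtp (R : realType) (B : 'M[R]_2) (alpha : R) (y : 'I_2)
    (pi : 'cV[R]_2) : R :=
  1 - eta B y pi i1 0 / alpha.

Definition sensor_action (R : realType) (B : 'M[R]_2) (alpha : R)
    (pi : 'cV[R]_2) (u : R) (y : 'I_2) : 'I_2 :=
  if u <= wtp B alpha y pi then i2 else i1.

Definition uH (R : realType) (B : 'M[R]_2) (alpha : R) (pi : 'cV[R]_2) : R :=
  wtp B alpha i2 pi.

Definition uL (R : realType) (B : 'M[R]_2) (alpha : R) (pi : 'cV[R]_2) : R :=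
  wtp B alpha i1 pi.

Inductive criterion := SelfInterested | Altruistic.

Section Control.
Variables (R : realType) (B : 'M[R]_2) (alpha beta rho : R).
Implicit Types (V mu : 'cV[R]_2 -> R) (pi : 'cV[R]_2).

Definition EV V pi : R :=
  obs_prob B i1 pi * V (eta B i1 pi) + obs_prob B i2 pi * V (eta B i2 pi).

(* Total discounted reward when charging uH (resp. uL) now and continuing
   optimally; the cut-off branch has value 0. *)
Definition QH (m : criterion) V pi : R :=
  match m with
  | SelfInterested =>
      (uH B alpha pi - beta) * obs_prob B i2 pi + rho * EV V pi
  | Altruistic => (uH B alpha pi - beta) + rho * EV V pi
  end.

Definition QL V pi : R := (uL B alpha pi - beta) + rho * V pi.

Definition bellman (m : criterion) V pi : R :=
  match m with
  | SelfInterested => Num.max 0 (Num.max (QL V pi) (QH m V pi))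
  | Altruistic => Num.max 0 (QH m V pi)
  end.

(* Boundedness singles out the value function among the solutions of the
   dynamic programming equation. *)
Definition value_function (m : criterion) V : Prop :=
  (exists M, forall pi, belief pi -> `|V pi| <= M) /\
  (forall pi, belief pi -> V pi = bellman m V pi).

Definition attains_max (m : criterion) (eps : R) V mu : Prop :=
  forall pi, belief pi ->
    [\/ mu pi = uH B alpha pi + eps /\ V pi = 0,
        mu pi = uH B alpha pi /\ V pi = QH m V pi
      | [/\ m = SelfInterested, mu pi = uL B alpha pi & V pi = QL V pi]].

Definition threshold_policy (m : criterion) (eps : R) mu : Prop :=
  match m with
  | SelfInterested =>
      exists p1 p2 : R,
        [/\ 0 <= p1 <= 1, 0 <= p2 <= 1 & forall pi, belief pi ->
          [/\ pi i2 0 < p1 -> mu pi = uH B alpha pi + eps,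
              p1 <= pi i2 0 < p2 -> mu pi = uH B alpha pi
            & p2 <= pi i2 0 -> mu pi = uL B alpha pi]]
  | Altruistic =>
      exists p : R,
        0 < p < 1 /\ forall pi, belief pi ->
          (pi i2 0 < p -> mu pi = uH B alpha pi + eps) /\
          (p <= pi i2 0 -> mu pi = uH B alpha pi)
  end.

Definition optimal_policy (m : criterion) (eps : R) mu : Prop :=
  threshold_policy m eps mu /\
  exists2 V, value_function m V & attains_max m eps V mu.

End Control.

(* Sensors act at times k >= 1: y 0, u 0 and a 0 are irrelevant. *)
Section Process.
Context {d : measure_display} {T : measurableType d} {R : realType}.
Variable P : probability T R.
Implicit Types (u : nat -> T -> R) (a y : nat -> T -> 'I_2).

(* Joint law of the constant state x and the observations y_1, ..., y_n: x has
   law pi0 and, given x = i, the y_k are independent with law B i. *)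
Definition observation_model (B : 'M[R]_2) (pi0 : 'cV[R]_2) (x : T -> 'I_2) y :
    Prop :=
  [/\ forall i, measurable (x @^-1` [set i]),
      forall k j, measurable (y k @^-1` [set j])
    & forall n i (j : nat -> 'I_2),
        P [set t | x t = i /\ forall k, (1 <= k <= n)%N -> y k t = j k] =
        (pi0 i 0 * \prod_(1 <= k < n.+1) B i (j k))%:E].

(* Event that the first k actions are those observed along the outcome t. *)
Definition same_actions a (k : nat) (t : T) : set T :=
  [set s | forall j, (1 <= j <= k)%N -> a j s = a j t].

(* Public belief P(x = i | a_1, ..., a_k) along the outcome t (with the value 0
   on the null event where the observed actions have probability 0). *)
Definition public_belief (x : T -> 'I_2) a (k : nat) (t : T) : 'cV[R]_2 :=
  \col_i (fine (P (x @^-1` [set i] `&` same_actions a k t)) /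
          fine (P (same_actions a k t))).

Definition market (B : 'M[R]_2) (alpha : R) (mu : 'cV[R]_2 -> R)
    (x : T -> 'I_2) y u a : Prop :=
  forall k t, (1 <= k)%N ->
    let pi := public_belief x a k.-1 t in
    u k t = mu pi /\ a k t = sensor_action B alpha pi (u k t) (y k t).

(* sigma(u_1, a_1, ..., u_k, a_k) *)
Definition history u a (k : nat) : set (set T) :=
  <<s [set A | exists2 j, (1 <= j <= k)%N &
        (exists2 U : set R, measurable U & A = u j @^-1` U) \/
        (exists i, A = a j @^-1` [set i])] >>.

(* Z is a version of E[X | G]. *)
Definition is_cond_expectation (G : set (set T)) (X Z : T -> R) : Prop :=
  [/\ P.-integrable setT (EFin \o Z),
      forall U : set R, measurable U -> G (Z @^-1` U)
    & forall A, G A ->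
        (\int[P]_(t in A) (Z t)%:E = \int[P]_(t in A) (X t)%:E)%E].

Definition supermartingale (F : nat -> set (set T)) (X : nat -> T -> R) : Prop :=
  forall n,
    [/\ P.-integrable setT (EFin \o X n),
        forall U : set R, measurable U -> F n (X n @^-1` U)
      & exists2 Z, is_cond_expectation (F n) (X n.+1) Z &
          {ae P, forall t, Z t <= X n t}].

End Process.

(* Main.v *)
Require Import Defs.
From mathcomp Require Import all_boot all_order all_algebra.
From mathcomp Require Import all_classical all_reals all_analysis.
From mathcomp Require Import ring lra.

Set Implicit Arguments.
Unset Strict Implicit.
Unset Printing Implicit Defensive.

Import Order.TTheory GRing.Theory Num.Theory.
Import numFieldNormedType.Exports.

Local Open Scope classical_set_scope.
Local Open Scope ring_scope.

(* The price changes only at beliefs where u^H is charged and the two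
   observations lead to different actions, so that a_k = y_k and the belief
   moves from pi to eta^y.  As a function of p = pi(2), u^H is affine in
   h(p) = eta^{y=2}(2) = c p / (a + D p), with a = 1 - B_11, c = B_22 and
   D = det B; h is concave, so Jensen's inequality gives
   E u^H(eta^y) <= u^H(pi), and u^L <= u^H only helps.  The cut-off price
   u^H + eps can occur only after y = 1, where V = 0 forces
   u^H(eta^{y=1}) <= beta.  The Jensen gap has a closed form which, under that
   constraint, is at least a constant times P(y = 1) as soon as p is bounded
   away from 0.  It is: V vanishes near 0, uniformly over all policies, because
   charging u^H there costs at least a fixed amount at each step while V never
   exceeds 1 / (1 - rho).  When B_11 = 1 one has u^H = 1 for p > 0 and
   no price exceeds 1. *)

(** * Two-point indices, the Bayes update in coordinates, and the determinant *)

Lemma ord2P (i : 'I_2) : i = i1 \/ i = i2.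
Proof.
by case: i => [[|[|//]] h]; [left|right]; apply: val_inj.
Qed.

Lemma sum_ord2 (V : nmodType) (f : 'I_2 -> V) : \sum_i f i = f i1 + f i2.
Proof. by rewrite !big_ord_recl big_ord0 addr0; congr (f _ + f _); apply: val_inj. Qed.

Lemma obs_mxE (R : realType) (B : 'M[R]_2) y (pi : 'cV[R]_2) i :
  (obs_mx B y *m pi) i 0 = B i y * pi i 0.
Proof. by rewrite /obs_mx mul_diag_mx !mxE. Qed.

Lemma obs_probE (R : realType) (B : 'M[R]_2) y (pi : 'cV[R]_2) :
  obs_prob B y pi = B i1 y * pi i1 0 + B i2 y * pi i2 0.
Proof.
by rewrite /obs_prob mxE sum_ord2 !obs_mxE !mxE !mul1r.
Qed.

Lemma eta0 (R : realType) (B : 'M[R]_2) y (pi : 'cV[R]_2) :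
  obs_prob B y pi = 0 -> eta B y pi = pi.
Proof. by rewrite /eta => ->; rewrite eqxx. Qed.

Lemma etaE (R : realType) (B : 'M[R]_2) y (pi : 'cV[R]_2) i :
  obs_prob B y pi != 0 -> eta B y pi i 0 = B i y * pi i 0 / obs_prob B y pi.
Proof. by rewrite /eta => /negPf ->; rewrite mxE obs_mxE mulrC. Qed.

(** With diagonal entries b and c, the determinant b c - (1 - b)(1 - c) of a row-stochastic matrix
    collapses to b + c - 1. *)
Lemma TP2E (R : realType) (B : 'M[R]_2) :
  row_stochastic B -> TP2 B ->
  [/\ 0 <= B i1 i1 <= 1, 0 <= B i2 i2 <= 1, B i1 i2 = 1 - B i1 i1,
      B i2 i1 = 1 - B i2 i2 & 0 <= B i1 i1 + B i2 i2 - 1].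
Proof.
move=> [B0 B1]; rewrite /TP2 (expand_det_row _ i1) sum_ord2 /cofactor !det_mx11 !mxE /=.
have -> : lift i1 0 = i2 by apply: val_inj.
have -> : lift i2 0 = i1 by apply: val_inj.
rewrite expr0 expr1 mul1r mulN1r.
have := B0 i1 i1; have := B0 i1 i2; have := B0 i2 i1; have := B0 i2 i2.
have := B1 i1; have := B1 i2; rewrite !sum_ord2.
move=> h2 h1 *.
have e1 : B i1 i2 = 1 - B i1 i1 by lra.
have e2 : B i2 i1 = 1 - B i2 i2 by lra.
by split=> //; first [nra | lra].
Qed.

(** Gives the number of steps after which a loss of [k] per step has used up [K]. *)
Lemma archi_step (R : realType) (K k : R) : 0 < k -> exists n : nat, K <= n%:R * k.
Proof.
move=> k0; exists (Num.bound `|K / k|).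
rewrite -ler_pdivrMr //; apply: (le_trans (ler_norm _)).
by apply/ltW/archi_boundP.
Qed.

(** * The Jensen gap of the posterior belief: closed form and lower bound *)

Lemma posterior_gapE (F : fieldType) (b c p : F) :
  let a := 1 - b in let d := b + c - 1 in
  let h q := c * q / (a + d * q) in
  let n1 := (1 - c) * p in let n2 := c * p in
  let s1 := b * (1 - p) + n1 in let s2 := a + d * p in
  s1 != 0 -> s2 != 0 -> a * s1 + d * n1 != 0 -> a * s2 + d * n2 != 0 ->
  h p - (s1 * h (n1 / s1) + s2 * h (n2 / s2)) =
  c * a * d ^+ 3 * p ^+ 2 * (1 - p) ^+ 2 /
    (s2 * (a * s2 + d * n2) * (a * s1 + d * n1)).
Proof.
move=> a d h n1 n2 s1 s2 hs1 hs2 ht1 ht2.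
(* Here [n1 / s1] and [n2 / s2] are the posterior values of p. The denominator of [h] at each,
   multiplied by [s1] or [s2], is linear in p, so clearing it leaves a rational identity in b, c,
   p. *)
have e1 : s1 * h (n1 / s1) = s1 * c * n1 / (a * s1 + d * n1).
  have -> : a * s1 + d * n1 = (a + d * (n1 / s1)) * s1.
    by rewrite [RHS]mulrDl -(mulrA d) divfK.
  rewrite /h invfM; field; rewrite hs1 /=.
  by apply: contraNneq ht1; rewrite mulrCA => e; apply/eqP; exact: e.
have e2 : s2 * h (n2 / s2) = s2 * c * n2 / (a * s2 + d * n2).
  have -> : a * s2 + d * n2 = (a + d * (n2 / s2)) * s2.
    by rewrite [RHS]mulrDl -(mulrA d) divfK.
  rewrite /h invfM; field; rewrite hs2 /=.
  by apply: contraNneq ht2; rewrite mulrCA => e; apply/eqP; exact: e.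
rewrite e1 e2 /h -/s2.
move: hs1 hs2 ht1 ht2; rewrite /s1 /s2 /n1 /n2 /a /d => hs1 hs2 ht1 ht2.
by field; rewrite ht1 ht2 hs2.
Qed.

(** In the closed form, [p >= delta] disposes of the factor p^2, and a (1 - p)^2 / (s2 t2 t1)
    remains to be compared with k^2 s1 / 2. The constraint on [h] yields k t1 <= a b (1 - p), hence
    k s1 <= b (1 - p); the product of the two suffices. *)
Lemma posterior_gap_ge (F : realFieldType) (b c p delta k : F) :
  let a := 1 - b in let d := b + c - 1 in
  let h q := c * q / (a + d * q) in
  let n1 := (1 - c) * p in let n2 := c * p in
  let s1 := b * (1 - p) + n1 in let s2 := a + d * p in
  0 < a -> 0 <= b -> c <= 1 -> 0 < d -> 0 < delta <= p -> p <= 1 ->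
  0 < s1 -> 0 <= k -> k <= 1 - h (n1 / s1) ->
  c * d ^+ 3 * delta ^+ 2 * k ^+ 2 / 2 * s1 <=
    h p - (s1 * h (n1 / s1) + s2 * h (n2 / s2)).
Proof.
move=> a d h n1 n2 s1 s2 a0 b0 c1 d0 /andP[de0 dep] p1 s10 k0 hk.
have c0 : 0 < c by move: a0 d0; rewrite /a /d; lra.
have p0 : 0 < p by apply: lt_le_trans dep.
have n10 : 0 <= n1 by rewrite mulr_ge0 //; lra.
have n20 : 0 < n2 by rewrite mulr_gt0.
have s20 : 0 < s2 by rewrite addr_gt0 // mulr_gt0.
have t10 : 0 < a * s1 + d * n1 by rewrite ltr_pwDl ?mulr_gt0 // mulr_ge0 // ltW.
have t20 : 0 < a * s2 + d * n2 by rewrite addr_gt0 // mulr_gt0.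
have s12 : s1 + s2 = 1 by rewrite /s1 /s2 /n1 /a /d; ring.
have a1 : a <= 1 by rewrite /a; lra.
have d1 : d <= 1 by rewrite /d; move: a0; rewrite /a; lra.
have s21 : s2 <= 1 by rewrite -s12 lerDr ltW.
have E := posterior_gapE (lt0r_neq0 s10) (lt0r_neq0 s20) (lt0r_neq0 t10) (lt0r_neq0 t20).
rewrite [X in _ <= X]E -/a -/d -/n1 -/n2 -/s1 -/s2.
set t1 := a * s1 + d * n1 in t10 *; set t2 := a * s2 + d * n2 in t20 *.
(* Source of the division by 2 in the bound. *)
have t22 : t2 <= 2.
  have h1 : a * s2 <= 1 by rewrite mulr_ile1 ?(ltW a0) ?(ltW s20).
  have h2 : d * n2 <= 1.
    by rewrite mulr_ile1 ?(ltW d0) ?(ltW n20) // mulr_ile1 ?(ltW c0) ?(ltW p0).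
  by rewrite (_ : 2 = 1 + 1) // lerD.
(* The complement 1 - h(n1 / s1) is exactly a b (1 - p) / t1. *)
have {}hk : k * t1 <= a * b * (1 - p).
  suff <- : (1 - h (n1 / s1)) * t1 = a * b * (1 - p) by rewrite ler_pM2r.
  have -> : h (n1 / s1) = c * n1 / t1.
    have -> : t1 = (a + d * (n1 / s1)) * s1.
      by rewrite [RHS]mulrDl -(mulrA d) divfK // lt0r_neq0.
    by rewrite /h invfM; ring.
  rewrite mulrBl mul1r divfK ?lt0r_neq0 // /t1 /s1 /n1 /a /d; ring.
have hs : k * s1 <= b * (1 - p).
  rewrite -(ler_pM2l a0) [leRHS]mulrA; apply: le_trans hk.
  by rewrite mulrCA ler_wpM2l // lerDl mulr_ge0 // ltW.
have pp : delta ^+ 2 <= p ^+ 2 by rewrite !expr2 ler_pM // ltW.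
have q0 : 0 <= 1 - p by lra.
rewrite ler_pdivlMr ?mulr_gt0 //.
have cd : 0 <= c * d ^+ 3 by rewrite mulr_ge0 ?exprn_ge0 // ltW.
have step : k ^+ 2 * s1 * t1 <= a * (1 - p) ^+ 2.
  have -> : k ^+ 2 * s1 * t1 = (k * s1) * (k * t1) by ring.
  have -> : a * (1 - p) ^+ 2 = (1 - p) * (a * (1 - p)) by ring.
  have b1 : b <= 1 by move: a0; rewrite /a; lra.
  have bp : b * (1 - p) <= 1 - p by rewrite ler_piMl.
  apply: ler_pM; rewrite ?mulr_ge0 ?(ltW s10) ?(ltW t10) //.
    exact: le_trans bp.
  by apply: le_trans hk _; rewrite -mulrA ler_wpM2l // ltW.
have st : s2 * t2 / 2 <= 1.
  rewrite ler_pdivrMr // mul1r; apply: le_trans t22.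
  by rewrite ler_piMl // ltW.
have -> : c * d ^+ 3 * delta ^+ 2 * k ^+ 2 / 2 * s1 * (s2 * t2 * t1) =
  (c * d ^+ 3) * delta ^+ 2 * (k ^+ 2 * s1 * t1) * (s2 * t2 / 2) by ring.
have -> : c * a * d ^+ 3 * p ^+ 2 * (1 - p) ^+ 2 =
  (c * d ^+ 3) * p ^+ 2 * (a * (1 - p) ^+ 2) by ring.
apply: (@le_trans _ _ (c * d ^+ 3 * delta ^+ 2 * (k ^+ 2 * s1 * t1))).
  by rewrite ler_piMr // !mulr_ge0 ?sqr_ge0 // ltW.
by rewrite ler_pM ?ler_wpM2l // !mulr_ge0 ?sqr_ge0 // ltW.
Qed.

(** * Beliefs, posteriors and the two candidate prices *)

Section Pricing.
Context (R : realType) (B : 'M[R]_2).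
Context (stochB : row_stochastic B) (tp2B : TP2 B).
Implicit Types (alpha beta rho eps : R) (pi q : 'cV[R]_2) (V mu : 'cV[R]_2 -> R).

Local Notation b := (B i1 i1).
Local Notation c := (B i2 i2).
Local Notation D := (b + c - 1).
Local Notation s1 := (obs_prob B i1).
Local Notation s2 := (obs_prob B i2).

Lemma beliefE pi : belief pi -> pi i1 0 = 1 - pi i2 0 /\ 0 <= pi i2 0 <= 1.
Proof. by case=> h1 h2; split; [lra|exact: h2]. Qed.

Lemma obs_prob1E pi : belief pi -> s1 pi = b * (1 - pi i2 0) + (1 - c) * pi i2 0.
Proof.
by case/beliefE => e _; rewrite obs_probE e; have [_ _ _ -> _] := TP2E stochB tp2B.
Qed.

Lemma obs_prob2E pi : belief pi -> s2 pi = (1 - b) + D * pi i2 0.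
Proof.
case/beliefE => e _; rewrite obs_probE e; have [_ _ -> _ _] := TP2E stochB tp2B; ring.
Qed.

Lemma obs_prob_sum pi : belief pi -> s1 pi + s2 pi = 1.
Proof. by move=> bpi; rewrite obs_prob1E // obs_prob2E //; ring. Qed.

Lemma obs_prob_ge0 y pi : belief pi -> 0 <= obs_prob B y pi.
Proof.
case=> _ pi01; rewrite obs_probE.
have pos i : 0 <= pi i 0 by case/andP: (pi01 i).
by rewrite addr_ge0 // mulr_ge0 // stochB.1.
Qed.

Lemma obs_prob_le1 y pi : belief pi -> obs_prob B y pi <= 1.
Proof.
move=> bpi; have := obs_prob_sum bpi.
have := obs_prob_ge0 i1 bpi; have := obs_prob_ge0 i2 bpi.
by case: (ord2P y) => ->; lra.
Qed.

Lemma belief_eta y pi : belief pi -> belief (eta B y pi).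
Proof.
move=> bpi; have [s0|s0] := eqVneq (obs_prob B y pi) 0; first by rewrite eta0.
have sgt0 : 0 < obs_prob B y pi by rewrite lt_def s0 obs_prob_ge0.
have sum1 : eta B y pi i1 0 + eta B y pi i2 0 = 1.
  by rewrite !etaE // -mulrDl -obs_probE divff.
have pos i : 0 <= eta B y pi i 0.
  rewrite etaE // divr_ge0 ?(ltW sgt0) // mulr_ge0 //; first exact: stochB.1.
  by case: bpi => _ /(_ i) /andP[].
split=> // i; rewrite pos /=.
by case: (ord2P i) => ->; [have := pos i2|have := pos i1]; lra.
Qed.

Lemma eta2_i2 pi : belief pi -> s2 pi != 0 ->
  eta B i2 pi i2 0 = c * pi i2 0 / s2 pi.
Proof. by move=> _ h; rewrite etaE. Qed.

Lemma eta1_i2 pi : belief pi -> s1 pi != 0 ->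
  eta B i1 pi i2 0 = (1 - c) * pi i2 0 / s1 pi.
Proof. by move=> _ h; rewrite etaE //; have [_ _ _ -> _] := TP2E stochB tp2B. Qed.

Lemma uHE alpha pi : belief pi -> s2 pi != 0 ->
  uH B alpha pi = 1 - (1 - c * pi i2 0 / s2 pi) / alpha.
Proof.
move=> bpi s0; rewrite /uH /wtp -eta2_i2 //.
by have [-> _] := beliefE (belief_eta i2 bpi).
Qed.

Lemma uH_le1 alpha pi : 0 < alpha -> belief pi -> uH B alpha pi <= 1.
Proof.
move=> alpha_gt0 bpi; rewrite /uH /wtp; have [_ /(_ i1) /andP[h _]] := belief_eta i2 bpi.
have : 0 <= eta B i2 pi i1 0 / alpha by rewrite divr_ge0 // ltW.
lra.
Qed.

Lemma le_wtp alpha y y' pi : 0 < alpha ->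
  (wtp B alpha y pi <= wtp B alpha y' pi) =
  (eta B y' pi i1 0 <= eta B y pi i1 0).
Proof. by move=> alpha_gt0; rewrite /wtp lerD2l lerN2 ler_pM2r // invr_gt0. Qed.

Lemma lt_wtp alpha y y' pi : 0 < alpha ->
  (wtp B alpha y pi < wtp B alpha y' pi) =
  (eta B y' pi i1 0 < eta B y pi i1 0).
Proof. by move=> alpha_gt0; rewrite !ltNge le_wtp. Qed.

(** After cross-multiplication both inequalities reduce to D p (1 - p) >= 0. The strict case is what
    separates the two willingness-to-pay levels, and it provides the positivity needed for division
    later. *)
Lemma eta_order pi : belief pi ->
  [/\ eta B i1 pi i2 0 <= pi i2 0, pi i2 0 <= eta B i2 pi i2 0
    & eta B i1 pi i1 0 > eta B i2 pi i1 0 ->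
      [/\ 0 < s1 pi, 0 < s2 pi, 0 < D & 0 < pi i2 0]].
Proof.
move=> bpi; have [e /andP[p0 p1]] := beliefE bpi.
have [/andP[b0 b1] /andP[c0 c1] _ _ D0] := TP2E stochB tp2B.
have sum1 := obs_prob_sum bpi; have E1 := obs_prob1E bpi; have E2 := obs_prob2E bpi.
have q1 := obs_prob_ge0 i1 bpi; have q2 := obs_prob_ge0 i2 bpi.
have [f1 _] := beliefE (belief_eta i1 bpi); have [f2 _] := beliefE (belief_eta i2 bpi).
(* If one observation has probability 0, both posteriors equal the prior: one by the default in
   [eta], the other because its observation is certain. *)
have [z1|n1] := eqVneq (s1 pi) 0.
  have E : eta B i2 pi i2 0 = pi i2 0.
    have s21 : s2 pi = 1 by lra.
    by rewrite eta2_i2 ?s21 ?oner_neq0 // divr1; nra.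
  by rewrite f1 f2 (eta0 z1) E; split => //; rewrite ltxx.
have [z2|n2] := eqVneq (s2 pi) 0.
  have E : eta B i1 pi i2 0 = pi i2 0.
    have s11 : s1 pi = 1 by lra.
    by rewrite eta1_i2 ?s11 ?oner_neq0 // divr1; nra.
  by rewrite f1 f2 (eta0 z2) E; split => //; rewrite ltxx.
have g1 : 0 < s1 pi by rewrite lt_def n1.
have g2 : 0 < s2 pi by rewrite lt_def n2.
rewrite f1 f2 eta1_i2 // eta2_i2 // ler_pdivrMr // ler_pdivlMr //.
have k1 : 0 <= D * pi i2 0 * (1 - pi i2 0) by do !apply: mulr_ge0; lra.
have le1 : (1 - c) * pi i2 0 <= pi i2 0 * s1 pi by rewrite E1; nra.
have le2 : pi i2 0 * s2 pi <= c * pi i2 0 by rewrite E2; nra.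
split=> // lt12.
(* If D p = 0, the observation probabilities given the two states agree or p = 0, so neither
   posterior moves, against the strict gap. *)
have D0p0 : 0 < D * pi i2 0.
  rewrite lt_def mulr_ge0 //.
  rewrite andbT; apply/eqP => Dp0.
  have k2 : c * pi i2 0 / s2 pi = pi i2 0.
    apply: (canLR (mulfK n2)); rewrite E2.
    have -> : c * pi i2 0 = (1 - b) * pi i2 0 + D * pi i2 0 by ring.
    by rewrite mulrDr mulrC Dp0 mulr0.
  have k3 : (1 - c) * pi i2 0 / s1 pi = pi i2 0.
    apply: (canLR (mulfK n1)); rewrite E1.
    have -> : (1 - c) * pi i2 0 = b * pi i2 0 - D * pi i2 0 by ring.
    have -> : b * (1 - pi i2 0) + (b * pi i2 0 - D * pi i2 0) = b - D * pi i2 0 by ring.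
    by rewrite Dp0 !subr0 mulrC.
  by rewrite k2 k3 ltxx in lt12.
split=> //; [rewrite lt_def|rewrite lt_def]; nra.
Qed.

Lemma uL_le_uH alpha pi : 0 < alpha -> belief pi -> uL B alpha pi <= uH B alpha pi.
Proof.
move=> alpha_gt0 bpi; have [h1 h2 _] := eta_order bpi; rewrite le_wtp //.
have [-> _] := beliefE (belief_eta i1 bpi); have [-> _] := beliefE (belief_eta i2 bpi).
lra.
Qed.

(** * Bounds on the value function *)

Lemma value_cases alpha beta rho m V pi : value_function B alpha beta rho m V -> belief pi ->
  [\/ V pi = 0, V pi = QH B alpha beta rho m V pi
    | V pi = QL B alpha beta rho V pi].
Proof.
move=> [_ HV] bpi; rewrite (HV _ bpi) /bellman.
have maxP (r r' : R) : Num.max r r' = r \/ Num.max r r' = r' by case: leP; auto.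
case: m {HV} => //; last by case: (maxP 0 (QH B alpha beta rho Altruistic V pi)) => ->;
  [constructor 1|constructor 2].
case: (maxP 0 (Num.max (QL B alpha beta rho V pi)
                       (QH B alpha beta rho SelfInterested V pi))) => ->.
  by constructor 1.
by case: (maxP (QL B alpha beta rho V pi)
               (QH B alpha beta rho SelfInterested V pi)) => ->;
  [constructor 3|constructor 2].
Qed.

Lemma value_ge0 alpha beta rho m V pi : value_function B alpha beta rho m V -> belief pi -> 0 <= V pi.
Proof. by move=> [_ HV] bpi; rewrite (HV _ bpi); case: m {HV}; rewrite le_max lexx. Qed.

Lemma QH_le_value alpha beta rho m V pi : value_function B alpha beta rho m V -> belief pi ->
  QH B alpha beta rho m V pi <= V pi.
Proof.
by move=> [_ HV] bpi; rewrite [leRHS](HV _ bpi); case: m {HV}; rewrite /bellman !le_max lexx !orbT.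
Qed.

Lemma EV_le V pi M : belief pi ->
  V (eta B i1 pi) <= M -> V (eta B i2 pi) <= M -> EV B V pi <= M.
Proof.
move=> bpi h1 h2; rewrite -[M]mul1r -(obs_prob_sum bpi) mulrDl.
by rewrite lerD // ler_wpM2l // obs_prob_ge0.
Qed.

Lemma EV_ge0 alpha beta rho m V pi : value_function B alpha beta rho m V -> belief pi -> 0 <= EV B V pi.
Proof.
move=> hV bpi; rewrite addr_ge0 // mulr_ge0 ?obs_prob_ge0 //;
  by apply: (value_ge0 hV); exact: belief_eta.
Qed.

(** Let s be the supremum of [V] over beliefs, finite by boundedness. Prices are at most 1, so the
    dynamic programming equation gives s <= 1 + rho s. *)
Lemma value_le alpha beta rho m V pi : 0 < alpha -> 0 <= beta -> 0 <= rho < 1 ->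
  value_function B alpha beta rho m V -> belief pi ->
  V pi <= 1 / (1 - rho).
Proof.
move=> alpha_gt0 beta_ge0 /andP[rho_ge0 rho_lt1] hV bpi.
have [s leS lub] : exists2 s, forall q, belief q -> V q <= s
    & forall M, (forall q, belief q -> V q <= M) -> s <= M.
  exists (sup [set V q | q in [set q | belief q]]) => [q bq|M HM].
    apply: ub_le_sup; last by exists q.
    have [[M HM] _] := hV; exists M => _ [q' bq' <-].
    exact: le_trans (ler_norm _) (HM q' bq').
  by apply: ge_sup => [|_ [q bq <-]]; [exists (V pi), pi|exact: HM].
have s0 : 0 <= s by apply: le_trans (leS _ bpi); exact: (value_ge0 hV).
suff : s <= 1 / (1 - rho) by apply: le_trans; exact: leS.
rewrite ler_pdivlMr ?subr_gt0 //.
suff : s <= 1 + rho * s by lra.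
apply: lub => q bq.
have u1 : uH B alpha q - beta <= 1 by have := uH_le1 alpha_gt0 bq; lra.
have u2 : uL B alpha q - beta <= 1 by have := uL_le_uH alpha_gt0 bq; lra.
case: (value_cases hV bq) => ->.
- by rewrite addr_ge0 // mulr_ge0.
- have E : rho * EV B V q <= rho * s.
    by rewrite ler_wpM2l // EV_le // leS //; exact: belief_eta.
  case: m {hV} => /=; apply: lerD => //.
  apply: le_trans (obs_prob_le1 i2 bq); rewrite -[leRHS]mul1r.
  by rewrite ler_wpM2r // obs_prob_ge0.
- by rewrite /QL lerD // ler_wpM2l // leS.
Qed.

Lemma QH_gt0 alpha beta rho m V pi : 0 <= rho ->
  value_function B alpha beta rho m V -> belief pi ->
  0 < s2 pi -> beta < uH B alpha pi -> 0 < QH B alpha beta rho m V pi.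
Proof.
move=> rho_ge0 hV bpi s20 bu; have E : 0 <= rho * EV B V pi.
  by rewrite mulr_ge0 //; exact: (EV_ge0 hV).
have u0 : 0 < uH B alpha pi - beta by lra.
by case: m {hV} => /=; rewrite ltr_pwDl // mulr_gt0.
Qed.

(** A common bound for the two criteria: the self-interested loss is incurred with probability
    [s2 pi], the altruistic one with certainty, which is worse. *)
Lemma QH_le alpha beta rho m V pi : 0 < beta -> belief pi -> uH B alpha pi <= beta / 2 ->
  QH B alpha beta rho m V pi <= - (beta / 2) * s2 pi + rho * EV B V pi.
Proof.
move=> beta_gt0 bpi hu; have h0 := obs_prob_ge0 i2 bpi; have h1 := obs_prob_le1 i2 bpi.
case: m => /=; rewrite lerD2r; first by rewrite ler_wpM2r //; lra.
apply: (@le_trans _ _ (- (beta / 2))); first by lra.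
by rewrite mulNr lerN2 ler_piMr // ltW // divr_gt0.
Qed.

(** * Constraints that optimality puts on the policy *)

Lemma policy_le_uHD alpha beta rho m eps mu pi : 0 < alpha ->
  optimal_policy B alpha beta rho m eps mu ->
  0 < eps -> belief pi -> mu pi <= uH B alpha pi + eps.
Proof.
move=> alpha_gt0 [_ [V hV att]] e0 bpi; have := uL_le_uH alpha_gt0 bpi.
by case: (att _ bpi) => [[-> _]|[-> _]|[_ -> _]]; lra.
Qed.

(** A price above [uH] can only come from the cut-off branch, where [V] vanishes; were [uH] above
    [beta], charging it would have positive value. *)
Lemma cutoff_uH_le alpha beta rho m eps mu pi : 0 < alpha -> 0 <= rho ->
  optimal_policy B alpha beta rho m eps mu ->
  0 < eps -> belief pi -> 0 < s2 pi ->
  uH B alpha pi < mu pi -> uH B alpha pi <= beta.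
Proof.
move=> alpha_gt0 rho_ge0 [_ [V hV att]] e0 bpi s20 umu; rewrite leNgt; apply/negP => bu.
have := QH_gt0 rho_ge0 hV bpi s20 bu; have := QH_le_value hV bpi; have := uL_le_uH alpha_gt0 bpi.
by case: (att _ bpi) => [[_ ->]|[e _]|[_ e _]]; lra.
Qed.

(** The threshold form enters here: charging [uH] at [pi] puts [pi] at or above the first threshold,
    since [eps > 0] tells [uH] from the cut-off price, and [q] lies further up. *)
Lemma uH_policy_up alpha beta rho m eps mu pi q : 0 < alpha ->
  optimal_policy B alpha beta rho m eps mu ->
  0 < eps -> belief pi -> belief q -> mu pi = uH B alpha pi ->
  pi i2 0 <= q i2 0 -> mu q <= uH B alpha q.
Proof.
move=> alpha_gt0 [thr _] e0 bpi bq; have := uL_le_uH alpha_gt0 bq.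
case: m thr => [[p1 [p2 [_ _ thr]]]|[p1 [_ thr]]].
- have [hp _ _] := thr _ bpi; have [_ h2 h3] := thr _ bq => uLH e pq.
  have p1p : p1 <= pi i2 0.
    by rewrite leNgt; apply/negP => /hp; rewrite e; lra.
  have [/h3 -> //|lt2] := leP p2 (q i2 0).
  by rewrite h2 // lt2 (le_trans p1p).
- have [hp _] := thr _ bpi; have [_ h2] := thr _ bq => uLH e pq.
  have p1p : p1 <= pi i2 0.
    by rewrite leNgt; apply/negP => /hp; rewrite e; lra.
  by rewrite h2 // (le_trans p1p).
Qed.

(** * The value function and the policy near belief 0 *)

Lemma eta_i2_le y pi : belief pi -> 0 < 1 - b ->
  (1 - b) * eta B y pi i2 0 <= pi i2 0.
Proof.
move=> bpi a0; have [_ /andP[p0 p1]] := beliefE bpi.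
have [/andP[b0 b1] /andP[c0 c1] _ _ D0] := TP2E stochB tp2B.
have [h1 _ _] := eta_order bpi.
have [_ /andP[q0 _]] := beliefE (belief_eta y bpi).
case: (ord2P y) q0 => -> q0; first by apply: le_trans h1; rewrite ler_piMl //; lra.
have s20 : 0 < s2 pi by rewrite obs_prob2E // ltr_pwDl // mulr_ge0.
rewrite eta2_i2 ?lt0r_neq0 // mulrA ler_pdivrMr // mulrA mulrC ler_wpM2l //.
by rewrite obs_prob2E //; nra.
Qed.

(** One observation brings the belief to at most beta alpha / 2, and since alpha <= 1, [uH] is at
    most that posterior divided by alpha. *)
Lemma uH_le_half alpha beta pi : 0 < alpha <= 1 -> 0 <= beta -> belief pi ->
  0 < 1 - b -> pi i2 0 <= beta * alpha / 2 * (1 - b) -> uH B alpha pi <= beta / 2.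
Proof.
move=> /andP[al0 al1] be0 bpi a0 hp; have := eta_i2_le i2 bpi a0.
rewrite /uH /wtp; have [-> _] := beliefE (belief_eta i2 bpi).
move/le_trans => /(_ _ hp); rewrite [leRHS]mulrC ler_pM2l // => he.
rewrite lerBlDl -lerBlDr ler_pdivlMr //; nra.
Qed.

(* As long as the belief is small, charging uH loses at least
   beta / 2 * (1 - b) and an observation multiplies the belief by at most
   1 / (1 - b). *)
Lemma value_decay alpha beta rho m V n pi :
  0 < alpha <= 1 -> 0 < beta -> 0 <= rho < 1 -> 0 < 1 - b ->
  value_function B alpha beta rho m V -> belief pi ->
  pi i2 0 <= beta * alpha / 2 * (1 - b) ^+ n.+1 ->
  V pi <= Num.max 0 (1 / (1 - rho) - n%:R * (beta / 2 * (1 - b))).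
Proof.
move=> al01 be0 rho01 a0 hV; have [al0 al1] := andP al01; have [r0 r1] := andP rho01.
have [/andP[b0 b1] /andP[c0 c1] _ _ D0] := TP2E stochB tp2B.
elim: n pi => [|n IH] pi bpi hp.
  by rewrite mul0r subr0 le_max (value_le _ _ rho01 hV) ?orbT // ltW.
have ab0 : 0 <= beta * alpha / 2 by rewrite divr_ge0 // mulr_ge0 // ltW.
have hp1 : pi i2 0 <= beta * alpha / 2 * (1 - b).
  apply: (le_trans hp); rewrite ler_wpM2l // exprS ler_piMr ?(ltW a0) //.
  by rewrite exprn_ile1 ?(ltW a0) //; lra.
have hu := uH_le_half al01 (ltW be0) bpi a0 hp1.
have [->|->|e] := value_cases hV bpi; first by rewrite le_max lexx.
- set M := Num.max 0 (1 / (1 - rho) - n%:R * (beta / 2 * (1 - b))).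
  have hM y : V (eta B y pi) <= M.
    apply: IH; first exact: belief_eta.
    rewrite -(ler_pM2l a0) (le_trans (eta_i2_le y bpi a0)) // mulrCA -exprS.
    exact: hp.
  have M0 : 0 <= M by rewrite le_max lexx.
  have rEV : rho * EV B V pi <= M.
    apply: (@le_trans _ _ (rho * M)); first by rewrite ler_wpM2l // EV_le.
    by rewrite ler_piMl // ltW.
  have hs : beta / 2 * (1 - b) <= beta / 2 * s2 pi.
    have [_ /andP[p0 _]] := beliefE bpi.
    by rewrite ler_wpM2l ?divr_ge0 ?(ltW be0) // obs_prob2E // lerDl mulr_ge0.
  apply: (le_trans (QH_le rho m V be0 bpi hu)).
  apply: (@le_trans _ _ (M - beta / 2 * (1 - b))); first by rewrite mulNr; lra.
  have k0 : 0 < beta / 2 * (1 - b) by rewrite mulr_gt0 // divr_gt0.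
  have -> : n.+1%:R = n%:R + 1 :> R by rewrite natr1.
  rewrite /M le_max; move: (1 / (1 - rho)) (beta / 2 * (1 - b)) k0 => K k k0.
  case: (leP 0 (K - n%:R * k)) => hK; apply/orP; [right|left]; last by lra.
  by rewrite mulrDl mul1r; lra.
(* The [uL] branch keeps the belief, so (1 - rho) V = uL - beta, which is negative because uL <= uH
   <= beta / 2; this contradicts V >= 0. *)
- have V0 := value_ge0 hV bpi; have uLH := uL_le_uH al0 bpi.
  have : (1 - rho) * V pi = uL B alpha pi - beta.
    by rewrite mulrBl mul1r {1}e /QL addrK.
  have : 0 <= (1 - rho) * V pi by rewrite mulr_ge0 // subr_ge0 ltW.
  lra.
Qed.

(** For [n] large, [value_decay] makes [V] vanish at both posteriors of a smaller belief, so
    charging [uH] there would be worth less than 0. The bound depends only on the model parameters,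
    not on the policy or [eps]. *)
Lemma uH_policy_ge alpha beta rho : 0 < alpha <= 1 -> 0 < beta -> 0 <= rho < 1 ->
  0 < 1 - b -> exists2 delta, 0 < delta & forall m eps mu pi, 0 < eps ->
    optimal_policy B alpha beta rho m eps mu -> belief pi ->
    mu pi = uH B alpha pi -> delta <= pi i2 0.
Proof.
move=> al01 be0 rho01 a0; have [al0 al1] := andP al01; have [r0 r1] := andP rho01.
have [/andP[b0 b1] /andP[c0 c1] _ _ D0] := TP2E stochB tp2B.
have k0 : 0 < beta / 2 * (1 - b) by rewrite mulr_gt0 // divr_gt0.
have [n hn] := archi_step (1 / (1 - rho)) k0.
(* One power more than in [value_decay], which is applied after one further observation. *)
exists (beta * alpha / 2 * (1 - b) ^+ n.+2).
  by rewrite mulr_gt0 ?exprn_gt0 // divr_gt0 // mulr_gt0.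
move=> m eps mu pi e0 [_ [V hV att]] bpi mue; rewrite leNgt; apply/negP => hp.
have hp1 : pi i2 0 <= beta * alpha / 2 * (1 - b).
  have ab0 : 0 <= beta * alpha / 2 by rewrite divr_ge0 // mulr_ge0 // ltW.
  apply: (le_trans (ltW hp)); rewrite ler_wpM2l // exprS ler_piMr ?(ltW a0) //.
  by rewrite exprn_ile1 ?(ltW a0) //; lra.
have hu := uH_le_half al01 (ltW be0) bpi a0 hp1.
have V0 := value_ge0 hV bpi; have uLH := uL_le_uH al0 bpi.
case: (att _ bpi) => [[e _]|[_ e]|[_ _ e]].
- by move: e; rewrite mue; lra.
- have hM y : V (eta B y pi) <= 0.
    have : V (eta B y pi) <= Num.max 0 (1 / (1 - rho) - n%:R * (beta / 2 * (1 - b))).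
      apply: (value_decay al01 be0 rho01 a0 hV); first exact: belief_eta.
      rewrite -(ler_pM2l a0) (le_trans (eta_i2_le y bpi a0)) // mulrCA -exprS.
      exact: ltW.
    by rewrite max_l // subr_le0.
  have rEV : rho * EV B V pi <= 0 by rewrite mulr_ge0_le0 // EV_le.
  have hs : 0 < beta / 2 * s2 pi.
    have [_ /andP[p0 _]] := beliefE bpi.
    by rewrite mulr_gt0 ?divr_gt0 // obs_prob2E // ltr_pwDl // mulr_ge0.
  by have := QH_le rho m V be0 bpi hu; rewrite -e mulNr; lra.
- have : (1 - rho) * V pi = uL B alpha pi - beta.
    by rewrite mulrBl mul1r {1}e /QL addrK.
  have : 0 <= (1 - rho) * V pi by rewrite mulr_ge0 // subr_ge0 ltW.
  lra.
Qed.

(** * The expected next price after a revealing price *)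

Lemma price_mix_le alpha (t1 t2 h h1 h2 m1 m2 e : R) : 0 < alpha ->
  0 <= t1 -> 0 <= t2 -> t1 + t2 = 1 ->
  m1 <= 1 - (1 - h1) / alpha + e -> m2 <= 1 - (1 - h2) / alpha ->
  alpha * e * t1 <= h - (t1 * h1 + t2 * h2) ->
  t1 * m1 + t2 * m2 <= 1 - (1 - h) / alpha.
Proof.
move=> al0 t10 t20 t12 hm1 hm2 gap.
have le1 := ler_wpM2l t10 hm1; have le2 := ler_wpM2l t20 hm2.
apply: (le_trans (lerD le1 le2)).
(* Prices are affine in h with slope 1 / alpha, so an overshoot [e] on the first branch costs alpha
   e t1 on the scale of h, which the gap pays for. *)
have -> : t1 * (1 - (1 - h1) / alpha + e) + t2 * (1 - (1 - h2) / alpha) =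
  (t1 + t2) - ((t1 + t2) - (alpha * e * t1 + (t1 * h1 + t2 * h2))) / alpha.
  by field; rewrite lt0r_neq0.
by rewrite t12 lerD2l lerN2 ler_pM2r ?invr_gt0 // lerD2l lerN2 -lerBrDr.
Qed.

Lemma posterior_price_le_lt1 alpha beta rho : 0 < alpha <= 1 -> 0 < beta < 1 ->
  0 <= rho < 1 -> 0 < 1 - b -> exists2 eps0, 0 < eps0 & forall m eps mu pi,
    0 < eps -> eps < eps0 -> optimal_policy B alpha beta rho m eps mu ->
    belief pi -> wtp B alpha i1 pi < wtp B alpha i2 pi ->
    mu pi = uH B alpha pi ->
    s1 pi * mu (eta B i1 pi) + s2 pi * mu (eta B i2 pi) <= mu pi.
Proof.
move=> al01 be01 rho01 a0; have [al0 al1] := andP al01; have [be0 be1] := andP be01.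
have [r0 r1] := andP rho01.
have [/andP[b0 b1] /andP[c0 c1] _ _ D0] := TP2E stochB tp2B.
have [delta d0 hdelta] := uH_policy_ge al01 be0 rho01 a0.
have orderD pi : belief pi -> wtp B alpha i1 pi < wtp B alpha i2 pi -> 0 < D.
  move=> bpi; rewrite lt_wtp // => wlt.
  by have [_ _ /(_ wlt)[]] := eta_order bpi.
(* With D = 0 the two levels never separate and any [eps0] will do. *)
have [Dz|Dn] := eqVneq D 0.
  exists 1 => // m eps mu pi _ _ _ bpi /(orderD _ bpi).
  by rewrite Dz ltxx.
have Dpos : 0 < D by rewrite lt_def Dn.
have cpos : 0 < c by lra.
(* The bound uH <= beta at the lower posterior, rewritten as k <= 1 - h. *)
pose k := alpha * (1 - beta).
have kpos : 0 < k by rewrite mulr_gt0 // subr_gt0.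
(* The constant of [posterior_gap_ge], divided by alpha to return to the price scale. *)
exists (c * D ^+ 3 * delta ^+ 2 * k ^+ 2 / 2 / alpha).
  do 2 (apply: divr_gt0 => //).
  by do 3 (apply: mulr_gt0; last exact: exprn_gt0).
move=> m eps mu pi e0 elt opt bpi wlt mue.
have [_ _ o] := eta_order bpi.
have [s10 s20 _ p0] : [/\ 0 < s1 pi, 0 < s2 pi, 0 < D & 0 < pi i2 0].
  by apply: o; move: wlt; rewrite lt_wtp //.
have [n1 n2] := (lt0r_neq0 s10, lt0r_neq0 s20).
have pdelta := hdelta _ _ _ _ e0 opt bpi mue.
have [_ /andP[_ p1]] := beliefE bpi.
have b1pi := belief_eta i1 bpi; have b2pi := belief_eta i2 bpi.
have s2pos q : belief q -> 0 < s2 q.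
  move=> bq; have [_ /andP[q0 _]] := beliefE bq.
  by rewrite obs_prob2E // ltr_pwDl // mulr_ge0.
pose h (r : R) := c * r / (1 - b + D * r).
have uHh q : belief q -> uH B alpha q = 1 - (1 - h (q i2 0)) / alpha.
  by move=> bq; rewrite uHE ?lt0r_neq0 ?s2pos // obs_prob2E.
have gap k' : 0 <= k' -> k' <= 1 - h (eta B i1 pi i2 0) ->
    c * D ^+ 3 * delta ^+ 2 * k' ^+ 2 / 2 * s1 pi <=
    h (pi i2 0) - (s1 pi * h (eta B i1 pi i2 0) + s2 pi * h (eta B i2 pi i2 0)).
  rewrite eta1_i2 // eta2_i2 // obs_prob1E // obs_prob2E // => k'0 hk'.
  apply: posterior_gap_ge => //; first by rewrite d0.
  by rewrite -obs_prob1E.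
rewrite mue uHh //.
have m2 : mu (eta B i2 pi) <= 1 - (1 - h (eta B i2 pi i2 0)) / alpha.
  rewrite -uHh //; apply: (uH_policy_up al0 opt e0 bpi b2pi mue).
  by have [] := eta_order bpi.
have [cut|ncut] := ltP (uH B alpha (eta B i1 pi)) (mu (eta B i1 pi)).
- have hb := cutoff_uH_le al0 r0 opt e0 b1pi (s2pos _ b1pi) cut.
  apply: (price_mix_le (e := eps) (h1 := h (eta B i1 pi i2 0))
    (h2 := h (eta B i2 pi i2 0))) => //;
    rewrite ?(ltW s10) ?(ltW s20) ?obs_prob_sum //.
    by rewrite -uHh //; exact: (policy_le_uHD al0 opt e0 b1pi).
  apply: le_trans (gap k (ltW kpos) _); last first.
    move: hb; rewrite uHh // lerBlDl -lerBlDr ler_pdivlMr // /k mulrC.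
    exact.
  rewrite ler_wpM2r ?(ltW s10) //.
  by rewrite mulrC -ler_pdivlMr // ltW.
(* Without cut-off after y = 1 there is no overshoot, and nonnegativity of the gap, its bound at k'
   = 0, is enough. *)
- apply: (price_mix_le (e := 0) (h1 := h (eta B i1 pi i2 0))
    (h2 := h (eta B i2 pi i2 0))) => //;
    rewrite ?(ltW s10) ?(ltW s20) ?obs_prob_sum //.
    by rewrite addr0 -uHh.
  rewrite mulr0 mul0r; apply: le_trans (gap 0 _ _) => //.
    by rewrite expr0n /= mulr0 !mul0r.
  have := uH_le1 al0 b1pi.
  by rewrite uHh // gerDl oppr_le0 pmulr_lge0 // invr_gt0.
Qed.

(** When b = 1, observing y = 2 proves high quality, so [uH] is 1 at every belief with p > 0 and the
    current price already equals the maximum. *)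
Lemma posterior_price_le_b1 alpha beta rho m eps mu pi :
  0 < alpha <= 1 -> 0 < beta < 1 -> 0 <= rho < 1 -> b = 1 -> 0 < eps < 1 ->
  optimal_policy B alpha beta rho m eps mu ->
  belief pi -> wtp B alpha i1 pi < wtp B alpha i2 pi ->
  mu pi = uH B alpha pi ->
  s1 pi * mu (eta B i1 pi) + s2 pi * mu (eta B i2 pi) <= mu pi.
Proof.
move=> /andP[al0 al1] /andP[be0 be1] /andP[r0 r1] eb /andP[e0 e1] opt bpi wlt mue.
have [_ _ o] := eta_order bpi.
have [s10 s20 Dpos p0] : [/\ 0 < s1 pi, 0 < s2 pi, 0 < D & 0 < pi i2 0].
  by apply: o; move: wlt; rewrite lt_wtp //.
have c0 : 0 < c by move: Dpos; rewrite eb; lra.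
have s2E q : belief q -> s2 q = c * q i2 0.
  by move=> bq; rewrite obs_prob2E // eb; ring.
have uH1 q : belief q -> 0 < q i2 0 -> uH B alpha q = 1.
  move=> bq q0; have cq0 : c * q i2 0 != 0 by rewrite lt0r_neq0 // mulr_gt0.
  by rewrite uHE // s2E // divff // subrr mul0r subr0.
have mu1 q : belief q -> mu q <= 1.
  move=> bq; have [_ /andP[q0 _]] := beliefE bq.
  move: q0; rewrite le_eqVlt => /orP[/eqP q0|q0].
  (* At p = 0 observation 2 is impossible, so [eta] keeps the belief and [uH] is 1 - 1 / alpha <= 0;
     here [eps < 1] keeps the cut-off price below 1. *)
  - apply: le_trans (policy_le_uHD al0 opt e0 bq) _.
    rewrite /uH /wtp eta0; last by rewrite s2E // -q0 mulr0.
    have [-> _] := beliefE bq; rewrite -q0 subr0.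
    have : 1 <= 1 / alpha by rewrite ler_pdivlMr // mul1r.
    lra.
  - rewrite leNgt; apply/negP => mq.
    have := @cutoff_uH_le _ _ _ _ _ _ q al0 r0 opt e0 bq.
    by rewrite s2E // uH1 // mulr_gt0 // => /(_ isT mq); lra.
rewrite mue uH1 // -(obs_prob_sum bpi) -[leRHS]mulr1 mulrDl.
by rewrite lerD // ler_wpM2l ?mu1 ?obs_prob_ge0 //; exact: belief_eta.
Qed.

Lemma posterior_price_le alpha beta rho : 0 < alpha <= 1 -> 0 < beta < 1 ->
  0 <= rho < 1 -> exists2 eps0, 0 < eps0 & forall m eps mu pi,
    0 < eps -> eps < eps0 -> optimal_policy B alpha beta rho m eps mu ->
    belief pi -> wtp B alpha i1 pi < wtp B alpha i2 pi ->
    mu pi = uH B alpha pi ->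
    s1 pi * mu (eta B i1 pi) + s2 pi * mu (eta B i2 pi) <= mu pi.
Proof.
move=> al01 be01 rho01; have [/andP[_ b1] _ _ _ _] := TP2E stochB tp2B.
have [eb|b_neq1] := eqVneq b 1; last first.
  by apply: posterior_price_le_lt1 => //; rewrite subr_gt0 lt_neqAle b_neq1.
exists 1 => // m eps mu pi e0 e1; apply: posterior_price_le_b1 => //.
by rewrite e0.
Qed.

End Pricing.

(** * Events determined by finitely many two-valued variables *)

Section Saturated.
Context {d : measure_display} {T : measurableType d}.
Implicit Types (f : nat -> T -> 'I_2) (A : set T).

Lemma same_actionsS f n t :
  same_actions f n.+1 t = same_actions f n t `&` [set s | f n.+1 s = f n.+1 t].
Proof.
apply/seteqP; split=> s /= => [h|[h1 h2] j /andP[j1]].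
  by split=> [j /andP[j1 jn]|]; apply: h; rewrite ?j1 /= ?leqnn // ltnW.
by rewrite leq_eqVlt ltnS => /orP[/eqP ->|jn] //; apply: h1; rewrite j1.
Qed.

Lemma same_actions0 f t : same_actions f 0 t = setT.
Proof. by apply/seteqP; split=> s //= _ [|j]. Qed.

Lemma same_actions_eq f n s t :
  same_actions f n t s -> same_actions f n s = same_actions f n t.
Proof.
by move=> st; apply/seteqP; split=> r /= h j jn; rewrite h // st.
Qed.

Lemma same_actions_le f m n t : (m <= n)%N ->
  same_actions f n t `<=` same_actions f m t.
Proof.
by move=> mn s h j /andP[j1 jm]; apply: h; rewrite j1 (leq_trans jm).
Qed.

(** Unions of atoms, that is, events decided by [f 1], ..., [f n], phrased pointwise so that no
    measurability is presupposed. It is applied to both observations and actions. *)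
Definition saturated f n A := forall s t, same_actions f n t s -> A t -> A s.

(* Induction over the finite algebra whose atoms are the sets
   [same_actions f n t]. *)
Lemma saturated_ind f n (Q : set T -> Prop) :
  Q set0 -> (forall A A', A `&` A' = set0 -> Q A -> Q A' -> Q (A `|` A')) ->
  (forall t, Q (same_actions f n t)) -> forall A, saturated f n A -> Q A.
Proof.
elim: n Q => [|n IH] Q Q0 QU Qa A satA.
  have [[t At]|/set0P/negP/negPn/eqP ->] := pselect (A !=set0); last exact: Q0.
  have <- : same_actions f 0 t = A; last exact: Qa.
  by rewrite same_actions0; apply/seteqP; split=> s // _; apply: satA At => -[|j].
(* [F i] is the level-n saturation of the slice of [A] where [f n.+1] equals i; cutting it back by
   that condition gives the slice [E i], so the induction hypothesis applies to [F i]. *)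
pose F i := [set t | exists s, [/\ A s, same_actions f n t s & f n.+1 s = i]].
pose E i := F i `&` f n.+1 @^-1` [set i].
have EA i s : E i s -> A s.
  move=> [[r [Ar rs fr]] fs]; apply: satA Ar; rewrite same_actionsS; split=> /=.
    by move=> j jn; rewrite rs.
  by rewrite fr.
have -> : A = E i1 `|` E i2.
  apply/seteqP; split=> s; last by case; exact: EA.
  by move=> As; case: (ord2P (f n.+1 s)) => fs; [left|right]; split=> //; exists s.
have QE i : Q (E i).
  apply: (IH (fun F => Q (F `&` f n.+1 @^-1` [set i]))); first by rewrite set0I.
  - move=> A1 A2 A12 Q1 Q2; rewrite setIUl; apply: QU => //.
    by rewrite setIACA A12 set0I.
  - move=> t; have [[s [st fs]]|no] :=
      pselect (exists s, same_actions f n t s /\ f n.+1 s = i).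
      by rewrite -(same_actions_eq st) -fs -same_actionsS.
    rewrite (_ : _ `&` _ = set0) //; apply/seteqP; split=> s // [st fs].
    by apply: no; exists s.
  - move=> s t st [r [Ar rt fr]]; exists r; split=> // j jn.
    by rewrite rt // st.
apply: QU => //; apply/seteqP; split=> s // -[[_ /= e1] [_ /= e2]].
by have : i1 = i2 by rewrite -e1 -e2.
Qed.

(** Atoms are finite intersections of level sets, and saturated sets are built from atoms by unions.
    It serves for the measurable sets and for the price-action history. *)
Lemma sigma_algebra_saturated (G : set (set T)) f n A : sigma_algebra setT G ->
  (forall j i, (1 <= j <= n)%N -> G (f j @^-1` [set i])) ->
  saturated f n A -> G A.
Proof.
move=> [G0 GC Gb] Gf.
have GU A1 A2 : G A1 -> G A2 -> G (A1 `|` A2).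
  by move=> G1 G2; rewrite -bigcup2E; apply: Gb => -[|[|k]].
have GI A1 A2 : G A1 -> G A2 -> G (A1 `&` A2).
  move=> G1 G2; rewrite -[_ `&` _]setCK setCI -!setTD.
  by apply: (GC); apply: GU; exact: GC.
apply: saturated_ind => // [A1 A2 _|t]; first exact: GU.
elim: n Gf => [|n IH] Gf.
  by rewrite same_actions0 -(setD0 setT); exact: GC.
rewrite same_actionsS; apply: GI.
  by apply: IH => j i /andP[j1 jn]; apply: Gf; rewrite j1 ltnW.
by apply: (Gf n.+1 (f n.+1 t)); rewrite /= leqnn.
Qed.

Lemma saturated_fiber (S : Type) f n (X : T -> S) (U : set S) :
  (forall s t, same_actions f n t s -> X s = X t) -> saturated f n (X @^-1` U).
Proof. by move=> hX s t /hX /= ->. Qed.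

End Saturated.

(** * Integrals of functions constant on atoms *)

Section SaturatedIntegral.
Context {d : measure_display} {T : measurableType d} {R : realType}.
Context (P : probability T R).
Context (f : nat -> T -> 'I_2) (mf : forall k j, measurable (f k.+1 @^-1` [set j])).
Implicit Types (A : set T) (X Z : T -> R).

Lemma measurable_saturated n A : saturated f n A -> measurable A.
Proof.
apply: sigma_algebra_saturated; first exact: sigma_algebra_measurable.
by move=> [//|j] i _; exact: mf.
Qed.

Lemma measurable_same_actions n t : measurable (same_actions f n t).
Proof.
apply: (@measurable_saturated n) => s r rs rt j jn.
by rewrite rs // rt.
Qed.

Lemma saturated_integrable n X :
  (forall s t, same_actions f n t s -> X s = X t) ->
  P.-integrable setT (EFin \o X).
Proof.
move=> hX; apply: measurable_bounded_integrable => //.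
- by apply: (@le_lt_trans _ _ 1%E); [exact: probability_le1|exact: ltry].
- move=> _ U mU; rewrite setTI.
  by apply: (@measurable_saturated n); exact: saturated_fiber.
(* Boundedness passes through disjoint unions, so [saturated_ind] gives it on the whole space. *)
- have [M HM] : exists M, forall t, setT t -> `|X t| <= M.
    apply: (@saturated_ind _ _ f n (fun A => exists M, forall t, A t -> `|X t| <= M)).
    + by exists 0.
    + move=> A1 A2 _ [M1 H1] [M2 H2]; exists (Num.max M1 M2) => t.
      by case=> [/H1|/H2]; rewrite le_max => ->; rewrite ?orbT.
    + by move=> t; exists `|X t| => s /hX ->.
    + by [].
  exists M; split; first exact: num_real.
  by move=> N MN t _ /=; rewrite (le_trans (HM t I)) // ltW.
Qed.

Lemma saturated_integral_eq n X Z :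
  P.-integrable setT (EFin \o X) -> P.-integrable setT (EFin \o Z) ->
  (forall t, (\int[P]_(s in same_actions f n t) (Z s)%:E =
              \int[P]_(s in same_actions f n t) (X s)%:E)%E) ->
  forall A, saturated f n A ->
  (\int[P]_(s in A) (Z s)%:E = \int[P]_(s in A) (X s)%:E)%E.
Proof.
move=> iX iZ hat A satA; pose Q A := measurable A /\
  (\int[P]_(s in A) (Z s)%:E = \int[P]_(s in A) (X s)%:E)%E.
suff [] : Q A by [].
apply: saturated_ind satA; first by split=> //; rewrite !integral_set0.
- move=> A1 A2 A12 [m1 e1] [m2 e2]; split; first exact: measurableU.
  have addI g : P.-integrable setT (EFin \o g) ->
    (\int[P]_(s in A1 `|` A2) (g s)%:E =
     \int[P]_(s in A1) (g s)%:E + \int[P]_(s in A2) (g s)%:E)%E.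
    move=> ig; rewrite integral_setU //; last exact/eqP.
    apply: measurable_int; apply: integrableS ig => //; exact: measurableU.
  by rewrite !addI // e1 e2.
- by move=> t; split; [exact: measurable_same_actions|exact: hat].
Qed.

End SaturatedIntegral.

(** * The market process: measurability and the law of the next observation *)

Section Market.
Context {d : measure_display} {T : measurableType d} {R : realType}.
Context (P : probability T R).
Implicit Types (A : set T).

Local Notation pr A := (fine (P A)).

Lemma prE A : measurable A -> P A = (pr A)%:E.
Proof. by move=> mA; rewrite fineK // fin_num_measure. Qed.

Lemma pr_ge0 A : 0 <= pr A.
Proof. exact: fine_ge0. Qed.

Lemma prU A A' : measurable A -> measurable A' -> A `&` A' = set0 ->
  pr (A `|` A') = pr A + pr A'.
Proof.
move=> mA mA' AA'; rewrite measureU // fineD //; exact: fin_num_measure.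
Qed.

Lemma pr_split (z : T -> 'I_2) A : (forall i, measurable (z @^-1` [set i])) ->
  measurable A ->
  pr A = pr (z @^-1` [set i1] `&` A) + pr (z @^-1` [set i2] `&` A).
Proof.
move=> mz mA; rewrite -prU; try exact: measurableI.
  congr (pr _); apply/seteqP; split=> s; last by case=> -[].
  by move=> As; case: (ord2P (z s)) => zs; [left|right].
apply/seteqP; split=> s // -[[/= e1 _] [/= e2 _]].
by have : i1 = i2 by rewrite -e1 -e2.
Qed.

Context (B : 'M[R]_2) (pi0 : 'cV[R]_2) (alpha : R) (mu : 'cV[R]_2 -> R).
Context (x : T -> 'I_2) (y : nat -> T -> 'I_2) (u : nat -> T -> R) (a : nat -> T -> 'I_2).
Context (obs : observation_model P B pi0 x y) (mkt : market P B alpha mu x y u a).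

Let mx : forall i, measurable (x @^-1` [set i]).
Proof. by case: obs. Qed.

Let my : forall k j, measurable (y k.+1 @^-1` [set j]).
Proof. by move=> k; case: obs. Qed.

Lemma next_price n t : u n.+1 t = mu (public_belief P x a n t).
Proof. by have [] := mkt t (ltn0Sn n). Qed.

Lemma next_action n t : a n.+1 t = sensor_action B alpha (public_belief P x a n t)
  (mu (public_belief P x a n t)) (y n.+1 t).
Proof. by rewrite -next_price; have [] := mkt t (ltn0Sn n). Qed.

Lemma public_belief_eq n s t : same_actions a n t s ->
  public_belief P x a n s = public_belief P x a n t.
Proof. by move=> st; rewrite /public_belief (same_actions_eq st). Qed.

Lemma next_price_eq n s t : same_actions a n t s -> u n.+1 s = u n.+1 t.
Proof. by move=> st; rewrite !next_price (public_belief_eq st). Qed.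

(** Inductively, past actions fix the belief and hence the price, so the next action depends only on
    the next observation. Measurability of actions and prices is derived from that of [y] this
    way. *)
Lemma same_observations_actions n s t : same_actions y n t s -> same_actions a n t s.
Proof.
elim: n => [|n IH]; first by rewrite !same_actions0.
rewrite !same_actionsS => -[/IH st /= yst]; split=> //=.
by rewrite !next_action (public_belief_eq st) yst.
Qed.

Lemma same_actions_saturated n t : saturated y n (same_actions a n t).
Proof.
move=> s r /same_observations_actions rs rt j jn.
by rewrite rs // rt.
Qed.

Lemma measurable_actions n t : measurable (same_actions a n t).
Proof. exact: (measurable_saturated my (@same_actions_saturated n t)). Qed.

Lemma measurable_action n i : measurable (a n.+1 @^-1` [set i]).
Proof.
apply: (measurable_saturated my (n := n.+1)); apply: saturated_fiber => s t st.
by apply: (same_observations_actions st); rewrite /= leqnn.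
Qed.

Lemma next_price_integrable n : P.-integrable setT (EFin \o u n.+1).
Proof.
apply: (saturated_integrable P my (n := n)) => s t st.
by apply: next_price_eq; exact: same_observations_actions.
Qed.

(** Conditional independence given the state: on an observation atom it compares two product
    formulas, and additivity extends it to all saturated events. *)
Lemma pr_observe n A i j : saturated y n A ->
  pr (x @^-1` [set i] `&` (A `&` y n.+1 @^-1` [set j])) =
  B i j * pr (x @^-1` [set i] `&` A).
Proof.
move=> satA; have mA := measurable_saturated my satA.
pose Q A := measurable A /\ pr (x @^-1` [set i] `&` (A `&` y n.+1 @^-1` [set j])) =
  B i j * pr (x @^-1` [set i] `&` A).
suff [] : Q A by [].
apply: saturated_ind satA.
- by split=> //; rewrite set0I !setI0 measure0 mulr0.
- move=> A1 A2 A12 [m1 e1] [m2 e2]; split; first exact: measurableU.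
  rewrite setIUl !setIUr !prU //; try by do ?apply: measurableI.
  + by rewrite e1 e2 mulrDr.
  + by rewrite setIACA A12 setI0.
  + by rewrite setIACA (setIACA A1) A12 set0I setI0.
- move=> t; split; first exact: measurable_same_actions.
  have [_ _ law] := obs.
  have -> : x @^-1` [set i] `&` same_actions y n t =
      [set s | x s = i /\ forall k, (1 <= k <= n)%N -> y k s = y k t] by [].
  (* The observed path along [t], extended by [j] at time n + 1. *)
  pose jj k := if k == n.+1 then j else y k t.
  have -> : x @^-1` [set i] `&` (same_actions y n t `&` y n.+1 @^-1` [set j]) =
      [set s | x s = i /\ forall k, (1 <= k <= n.+1)%N -> y k s = jj k].
    apply/seteqP; split=> s /= => [[xs [ys yj]]|[xs ys]]; split=> //.
      move=> k /andP[k1]; rewrite leq_eqVlt /jj => /orP[/eqP ->|kn].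
        by rewrite eqxx.
      by rewrite (ltn_eqF kn) ys // k1.
    split=> [k /andP[k1 kn]|]; last by rewrite ys ?leqnn // /jj eqxx.
    by rewrite ys ?k1 ?(leqW kn) // /jj (ltn_eqF (kn : (k < n.+1)%N)).
  rewrite !law /= big_nat_recr //= /jj eqxx.
  under eq_big_nat => k /andP[_ kn] do rewrite (ltn_eqF kn).
  by ring.
Qed.

(** * One period, on a history atom of positive probability *)

Section Step.
Context (n : nat) (t : T).
Local Notation E := (same_actions a n t).
Local Notation pi := (public_belief P x a n t).
Context (E0 : pr E != 0).

Let mE : measurable E. Proof. exact: measurable_actions. Qed.

Lemma public_beliefM i : pr (x @^-1` [set i] `&` E) = pi i 0 * pr E.
Proof. by rewrite mxE divfK. Qed.

Lemma belief_public_belief : belief pi.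
Proof.
have sum1 : pi i1 0 + pi i2 0 = 1.
  by rewrite !mxE -mulrDl -pr_split // divff.
have pos i : 0 <= pi i 0 by rewrite mxE divr_ge0 ?pr_ge0.
split=> // i; rewrite pos /= -sum1.
by case: (ord2P i) => ->; rewrite ?lerDl ?lerDr.
Qed.

Lemma pr_next_observation j :
  pr (E `&` y n.+1 @^-1` [set j]) = obs_prob B j pi * pr E.
Proof.
rewrite (pr_split mx); last exact: measurableI.
rewrite !pr_observe; try exact: same_actions_saturated.
by rewrite !public_beliefM obs_probE; ring.
Qed.

(** If both observations lead to the same action, the next action does not cut the atom, and the
    belief stays put. *)
Lemma uninformative_price s : E s ->
  (forall j j', sensor_action B alpha pi (mu pi) j = sensor_action B alpha pi (mu pi) j') ->
  u n.+2 s = mu pi.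
Proof.
move=> Es hc; rewrite next_price /public_belief.
suff -> : same_actions a n.+1 s = E by [].
rewrite same_actionsS (same_actions_eq Es); apply/seteqP; split=> r; first by case.
move=> Er; split=> //=; rewrite !next_action (public_belief_eq Er) (public_belief_eq Es).
exact: hc.
Qed.

(** If the action repeats the observation, the atom is cut exactly by y_{n+1}, and conditioning on
    it is the Bayes update [eta]. *)
Lemma revealing_price s : E s ->
  (forall j, sensor_action B alpha pi (mu pi) j = j) ->
  obs_prob B (y n.+1 s) pi != 0 ->
  u n.+2 s = mu (eta B (y n.+1 s) pi).
Proof.
move=> Es hc s0; rewrite next_price; congr mu.
have eE : same_actions a n.+1 s = E `&` y n.+1 @^-1` [set y n.+1 s].
  rewrite same_actionsS (same_actions_eq Es); apply/seteqP.
  by split=> r [Er] /=; rewrite !next_action (public_belief_eq Er)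
    (public_belief_eq Es) !hc.
apply/matrixP => i k; rewrite (ord1 k) etaE // mxE eE.
rewrite pr_observe; last exact: same_actions_saturated.
rewrite pr_next_observation public_beliefM; field.
by rewrite s0.
Qed.

(** In the revealing case the atom splits into two pieces of relative weights [obs_prob], with the
    next price constant on each. *)
Lemma next_price_integral_le :
  (forall j j', sensor_action B alpha pi (mu pi) j = sensor_action B alpha pi (mu pi) j') \/
  [/\ forall j, sensor_action B alpha pi (mu pi) j = j,
      forall j, obs_prob B j pi != 0
    & obs_prob B i1 pi * mu (eta B i1 pi) + obs_prob B i2 pi * mu (eta B i2 pi)
      <= mu pi] ->
  (\int[P]_(s in E) (u n.+2 s)%:E <= (u n.+1 t * pr E)%:E)%E.
Proof.
have cst A c : measurable A -> (forall s, A s -> u n.+2 s = c) ->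
    (\int[P]_(s in A) (u n.+2 s)%:E = (c * pr A)%:E)%E.
  move=> mA hc; rewrite (eq_integral (cst c%:E)).
    by rewrite integral_cst // EFinM -prE.
  by move=> s; rewrite inE => /hc ->.
move=> [hc|[hc s0 le]].
  by rewrite (cst _ (mu pi)) ?next_price // => s Es; exact: uninformative_price.
pose F j := E `&` y n.+1 @^-1` [set j].
have mF j : measurable (F j) by exact: measurableI.
have F12 : E = F i1 `|` F i2.
  apply/seteqP; split=> s; last by case=> -[].
  by move=> Es; case: (ord2P (y n.+1 s)) => ys; [left|right].
have -> : (\int[P]_(s in E) (u n.+2 s)%:E =
    \int[P]_(s in F i1) (u n.+2 s)%:E + \int[P]_(s in F i2) (u n.+2 s)%:E)%E.
  rewrite {1}F12 integral_setU //.
  - apply: measurable_int; apply: integrableS (next_price_integrable n.+1) => //.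
    exact: measurableU.
  - apply/eqP/seteqP; split=> s // -[[_ /= e1] [_ /= e2]].
    by have : i1 = i2 by rewrite -e1 -e2.
have intF j : (\int[P]_(s in F j) (u n.+2 s)%:E =
    (mu (eta B j pi) * (obs_prob B j pi * pr E))%:E)%E.
  rewrite (cst _ (mu (eta B j pi))) ?pr_next_observation // => s [Es <-].
  exact: revealing_price.
rewrite !intF -EFinD lee_fin next_price.
apply: le_trans (ler_wpM2r (pr_ge0 E) le).
by rewrite le_eqVlt; apply/orP; left; apply/eqP; ring.
Qed.

End Step.

(** * The history and the conditional expectation of the next price *)

Lemma history_saturated n A : history u a n A -> saturated a n A.
Proof.
apply: (@smallest_sub _ _ _ [set A | saturated a n A]).
  split=> [s r //|A1 sat1 s r sr /= [_ h]|F satF s r sr [k _ Fr]].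
  - split=> // As; apply: h; apply: sat1 As => j jn.
    by rewrite sr.
  - by exists k => //; exact: satF Fr.
move=> _ [j /andP[j1 jn] [[U mU ->]|[i ->]]] s r sr /=.
  case: j j1 jn => // j _ jn.
  (* The price at time j + 1 depends on the first j actions only, so prices add nothing to the
     information in the actions. *)
  by rewrite (@next_price_eq j s r) //; apply: same_actions_le sr; exact: ltnW.
by rewrite sr // j1.
Qed.

Lemma saturated_history n A : saturated a n A -> history u a n A.
Proof.
apply: sigma_algebra_saturated; first exact: smallest_sigma_algebra.
by move=> j i jn; apply: sub_gen_smallest; exists j => //; right; exists i.
Qed.

(** The history is generated by finitely many atoms, so the conditional expectation [Z] is the
    average of the next price over each atom. Index n carries u_{n+1}, which the first n actions
    already determine. *)
Lemma price_supermartingale :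
  (forall pi, belief pi ->
    (forall j j', sensor_action B alpha pi (mu pi) j = sensor_action B alpha pi (mu pi) j') \/
    [/\ forall j, sensor_action B alpha pi (mu pi) j = j,
        forall j, obs_prob B j pi != 0
      & obs_prob B i1 pi * mu (eta B i1 pi) + obs_prob B i2 pi * mu (eta B i2 pi)
        <= mu pi]) ->
  supermartingale P (history u a) (fun n => u n.+1).
Proof.
move=> step n; split; first exact: next_price_integrable.
  by move=> U _; apply: saturated_history; apply: saturated_fiber; exact: next_price_eq.
pose E t := same_actions a n t.
pose I t := (\int[P]_(s in E t) (u n.+2 s)%:E)%E.
have iX := next_price_integrable n.+1.
have mE t : measurable (E t) by exact: measurable_actions.
have IE t : I t = (fine (I t))%:E.
  rewrite fineK //; apply: integrable_fin_num => //.
  exact: integrableS iX.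
(* On null atoms any value will do; u n.+1 makes Z <= u n.+1 hold everywhere. *)
pose Z t := if pr (E t) == 0 then u n.+1 t else fine (I t) / pr (E t).
have Zc s t : same_actions a n t s -> Z s = Z t.
  move=> st; have EE : E s = E t by exact: same_actions_eq.
  by rewrite /Z /I EE (next_price_eq st).
have iZ : P.-integrable setT (EFin \o Z).
  apply: (saturated_integrable P my (n := n)) => s t st.
  by apply: Zc; exact: same_observations_actions.
exists Z; last first.
  apply: aeW => t; rewrite /Z; case: eqP => // /eqP E0.
  rewrite ler_pdivrMr; last by rewrite lt_def E0 pr_ge0.
  rewrite -lee_fin -IE; apply: next_price_integral_le => //.
  by apply: step; exact: belief_public_belief.
split=> //.
  by move=> U _; apply: saturated_history; exact: saturated_fiber.
move=> A /history_saturated; apply: (saturated_integral_eq measurable_action iX iZ) => t.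
have -> : (\int[P]_(s in same_actions a n t) (Z s)%:E = (Z t * pr (E t))%:E)%E.
  rewrite (eq_integral (cst (Z t)%:E)).
    by rewrite integral_cst // EFinM -prE.
  by move=> s; rewrite inE => /Zc ->.
rewrite -/(I t) IE /Z; case: eqP => [E0|/eqP E0]; last by rewrite divfK.
rewrite E0 mulr0 /I; congr EFin.
(* On a null atom both integrals are 0, whatever value [Z] takes there. *)
rewrite (@negligible_integral _ _ _ P _ (E t)) ?setDv ?integral_set0 //.
- exact: integrableS iX.
- by have := prE (mE t); rewrite E0.
Qed.

End Market.

(** * Price regions and the super-martingale property for small [eps] *)

Theorem theorem5 (R : realType) (B : 'M[R]_2) (alpha beta rho : R)
    (m : criterion) :
  row_stochastic B -> TP2 B ->
  0 < alpha <= 1 -> 0 < beta < 1 -> 0 <= rho < 1 ->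
  \forall eps \near 0^'+,
    forall (mu : 'cV[R]_2 -> R) (pi0 : 'cV[R]_2)
      (d : measure_display) (T : measurableType d) (P : probability T R)
      (x : T -> 'I_2) (y : nat -> T -> 'I_2)
      (u : nat -> T -> R) (a : nat -> T -> 'I_2),
    optimal_policy B alpha beta rho m eps mu ->
    belief pi0 ->
    observation_model P B pi0 x y ->
    market P B alpha mu x y u a ->
    supermartingale P (history u a) (fun n => u n.+1).
Proof.
move=> stochB tp2B al01 be01 rho01.
(* [eps0] is fixed before the policy and the probability space, as the neighbourhood filter
   requires. *)
have [eps0 eps0_gt0 core] := posterior_price_le stochB tp2B al01 be01 rho01.
have [al0 _] := andP al01.
near=> eps; move=> mu pi0 d T P x y u a opt bpi0 obs mkt.
have e0 : 0 < eps by near: eps; exact: nbhs_right_gt.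
have elt : eps < eps0 by near: eps; exact: nbhs_right_lt.
apply: (price_supermartingale obs mkt) => pi bpi.
have wle : wtp B alpha i1 pi <= wtp B alpha i2 pi := uL_le_uH stochB tp2B al0 bpi.
(* Above both willingness-to-pay levels nobody utilizes and below both everybody does, so the action
   is uninformative; only strictly above the lower and up to the higher level does it reveal the
   observation. *)
have [hi|lo] := ltP (wtp B alpha i2 pi) (mu pi).
  left=> j j'; suff no k : sensor_action B alpha pi (mu pi) k = i1 by rewrite !no.
  rewrite /sensor_action leNgt; case: (ord2P k) => ->; last by rewrite hi.
  by rewrite (le_lt_trans wle hi).
have [mu_le|w_lt] := leP (mu pi) (wtp B alpha i1 pi).
  left=> j j'; suff yes k : sensor_action B alpha pi (mu pi) k = i2 by rewrite !yes.
  by rewrite /sensor_action; case: (ord2P k) => ->; rewrite ?mu_le ?lo.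
have wlt : wtp B alpha i1 pi < wtp B alpha i2 pi := lt_le_trans w_lt lo.
have [_ _ o] := eta_order stochB tp2B bpi.
have [s10 s20 _ _] := o (etrans (esym (lt_wtp _ _ _ _ al0)) wlt).
right; split.
- move=> j; rewrite /sensor_action; case: (ord2P j) => ->; last by rewrite lo.
  by rewrite leNgt w_lt.
- by move=> j; case: (ord2P j) => ->; rewrite lt0r_neq0.
- apply: (core _ _ _ _ e0 elt opt bpi wlt).
  (* In this region the cut-off price is too high and [uL] too low, which leaves [uH]. *)
  have [_ [V _ /(_ _ bpi)]] := opt; rewrite /uH /uL.
  by case=> [[e _]|[-> //]|[_ e _]]; move: lo w_lt; rewrite e ?ltxx // gerDl leNgt e0.
Unshelve. all: by end_near.
Qed.
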